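(* Let $\Omega$ and $\Omega'$ be tiling spaces of substitutions, with their translation actions of $\mathbb{R}$. (i) If $\Omega$ and $\Omega'$ are orbit equivalent (there is a homeomorphism $\Omega\to\Omega'$ mapping $\mathbb{R}$-orbits to $\mathbb{R}$-orbits), then $\check{H}^*(D_\Omega)\cong\check{H}^*(D_{\Omega'})$ and $\check{H}^*(D^\Omega)\cong\check{H}^*(D^{\Omega'})$ as diagrams of groups. (ii) If $\check{H}^*(D_\Omega)\cong\check{H}^*(D_{\Omega'})$, or if $\check{H}^*(D^\Omega)\cong\check{H}^*(D^{\Omega'})$, as diagrams of groups, then $\check{H}^*(\Omega)\cong\check{H}^*(\Omega')$. That is, both $\check{H}^*(D_\Omega)$ and $\check{H}^*(D^\Omega)$ are at least as strong an invariant of tiling spaces (up to orbit equivalence) as Čech cohomology.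
   Context: Tiling spaces. A substitution on a finite alphabet $\mathcal{A}$ is a function $\varphi:\mathcal{A}\to\mathcal{A}^+$ (non-empty finite words), extended to words by concatenation. $X_\varphi$ is the set of $w\in\mathcal{A}^{\mathbb{Z}}$ each of whose finite subwords is a subword of $\varphi^k(a)$ for some $a\in\mathcal{A}$, $k\ge0$, with the shift $\sigma(w)_i=w_{i+1}$. The tiling space is $\Omega_\varphi=(X_\varphi\times[0,1])/{\sim}$ with $\sim$ generated by $(w,1)\sim(\sigma(w),0)$, with $\mathbb{R}$-action $\rho((w,t),\tau)=(\sigma^{\lfloor t+\tau\rfloor}(w),\,t+\tau\bmod 1)$. Diagrams. A closed invariant subspace (CIS) of $\Omega$ is a closed subset $\Lambda$ with $\rho(\Lambda,\tau)=\Lambda$ for all $\tau$; the set $\mathcal{C}$ of CISs (including $\emptyset$ and $\Omega$) is a lattice under inclusion. The inclusion diagram $D_\Omega$ has objects the $\Lambda\in\mathcal{C}$ and arrows the inclusions $\Lambda_j\to\Lambda_k$ for $\Lambda_j\subset\Lambda_k$. The quotient diagram $D^\Omega$ has objects $\Omega/\Lambda$ ($\Lambda\in\mathcal{C}$; $\Lambda$ collapsed to a point, with $\Omega/\emptyset=\Omega$) and arrows the quotient maps $\Omega/\Lambda_j\to\Omega/\Lambda_k$ for $\Lambda_j\subset\Lambda_k$. The inclusion cohomology diagram $\check{H}^*(D_\Omega)$ and quotient cohomology diagram $\check{H}^*(D^\Omega)$ are the diagrams of abelian groups obtained by applying the Čech cohomology functor (integer coefficients). An isomorphism of such diagrams is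 an isomorphism of the indexing lattices of CISs together with isomorphisms between corresponding groups that commute with the arrows. *)

(* Defs.v *)
From HB Require Import structures.
From Stdlib Require Import Relation_Operators.
From mathcomp Require Import all_boot all_order all_algebra generic_quotient.
From mathcomp Require Import all_classical all_reals all_analysis.
From mathcomp Require Import zify ring lra.
Import Order.TTheory GRing.Theory Num.Theory numFieldNormedType.Exports.

Set Implicit Arguments.
Unset Strict Implicit.
Unset Printing Implicit Defensive.

Local Open Scope classical_set_scope.
Local Open Scope quotient_scope.
Local Open Scope ring_scope.

(** [cech n X] below is the direct limit, over the open covers of [X] ordered by
    refinement, of the degree [n] simplicial cohomology of their nerves. *)

Section Cochains.
Variable T : Type.
Implicit Types (c b : seq T -> int) (s t : seq T) (p q : T -> T).

Definition delta c s : int :=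
  \sum_(i < size s) (-1) ^+ i * c (take i s ++ drop i.+1 s).

Lemma delta_nil c : delta c [::] = 0.
Proof. by rewrite /delta big_ord0. Qed.

Lemma delta_cons c x s :
  delta c (x :: s) = c s - delta (fun t => c (x :: t)) s.
Proof.
rewrite /delta big_ord_recl /= expr0 mul1r drop0; congr (_ + _).
rewrite -sumrN; apply: eq_bigr => i _.
by rewrite exprS mulN1r mulNr.
Qed.

Lemma deltaD c b : delta (c \+ b) =1 delta c \+ delta b.
Proof.
by move=> s; rewrite /delta /= -big_split; apply: eq_bigr => i _; rewrite /= mulrDr.
Qed.

Lemma deltaN c : delta (\- c) =1 \- delta c.
Proof.
by move=> s; rewrite /delta /= -sumrN; apply: eq_bigr => i _; rewrite /= mulrN.
Qed.

End Cochains.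

Lemma delta_map (S T : Type) (p : S -> T) (c : seq T -> int) s :
  delta (fun t => c (map p t)) s = delta c (map p s).
Proof.
rewrite /delta size_map; apply: eq_bigr => i _.
by rewrite map_cat map_take map_drop.
Qed.

(** A chain homotopy between the cochain maps induced by
    two vertex maps. *)
Section Prism.
Variables (S T : choiceType) (p q : S -> T).
Implicit Types (c b : seq T -> int) (s : seq S).

Fixpoint prism (c : seq T -> int) (s : seq S) : int :=
  if s is x :: t then
    c (p x :: map q s) - prism (fun u => c (p x :: u)) t
  else 0.

Lemma prismB c b s : prism (c \- b) s = prism c s - prism b s.
Proof.
elim: s c b => [|x s IH] c b /=; first by rewrite subr0.
by rewrite (IH (fun u => c (p x :: u)) (fun u => b (p x :: u))) !opprB; ring.
Qed.

Lemma prism_eq0 c s :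
  (forall t, size t = (size s).+1 -> {subset t <= map p s ++ map q s} ->
    c t = 0) -> prism c s = 0.
Proof.
elim: s c => [//|x s IH] c c0 /=.
have -> : c [:: p x, q x & map q s] = 0.
  apply: c0 => [|y]; first by rewrite /= size_map.
  by rewrite mem_cat !inE => /or3P[]->; rewrite ?orbT.
rewrite sub0r IH ?oppr0// => t st sub; apply: c0; first by rewrite /= st.
move=> y; rewrite inE => /orP[/eqP ->|/sub]; first by rewrite mem_head.
by rewrite !mem_cat !inE => /orP[->|->]; rewrite !orbT.
Qed.

Lemma prismP c s :
  delta (prism c) s + prism (delta c) s = c (map q s) - c (map p s).
Proof.
elim: s c => [|x s IH] c; first by rewrite delta_nil /= add0r subrr.
rewrite delta_cons.
have -> : (fun t => prism c (x :: t)) =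
  (fun t => c (p x :: q x :: map q t)) \+
  (\- prism (fun u => c (p x :: u))) by [].
rewrite deltaD /= deltaN /= (delta_map q (fun u => c [:: p x, q x & u])).
rewrite !delta_cons.
have -> : (fun u => delta c (p x :: u)) =
  c \- delta (fun u => c (p x :: u)) by apply/funext => u; rewrite delta_cons.
rewrite prismB; have := IH (fun u => c (p x :: u)).
by move: (delta _ _) (prism (delta _) _) (delta _ _) => A B C /=; lia.
Qed.

End Prism.

Definition open_cover (X : topologicalType) (U : set (set X)) : Prop :=
  U `<=` open /\ \bigcup_(A in U) A = setT.

(** The (ordered) simplices of the nerve of a cover, listed by vertices. *)
Definition nerve (X : Type) (U : set (set X)) : set (seq (set X)) :=
  [set s : seq (set X) |
    [set` s] `<=` U /\ \bigcap_(A in [set` s]) A !=set0].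

(** An [n]-cochain of the nerve of [U] is represented by any function on
    sequences agreeing with it on the simplices with [n.+1] vertices; all the
    conditions below only inspect values on simplices of the nerve. *)
Definition cocycle (X : Type) (U : set (set X)) n (c : seq (set X) -> int) :=
  forall s, nerve U s -> size s = n.+2 -> delta c s = 0.

(** The condition on [b] only matters for [n = 0]: it expresses that there are
    no nonzero cochains of degree [-1]. *)
Definition coboundary (X : Type) (U : set (set X)) n (c : seq (set X) -> int) :=
  exists2 b, b [::] = 0 &
    forall s, nerve U s -> size s = n.+1 -> c s = delta b s.

(** [p] selects for every member of the cover [W] of [X] a member of the cover
    [U] of [Y] containing its image under [f]; for [f = idfun] this is a
    refinement map. *)
Definition refines (X Y : Type) (f : X -> Y)
    (W : set (set X)) (U : set (set Y)) (p : set X -> set Y) :=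
  forall A, W A -> U (p A) /\ A `<=` f @^-1` (p A).

Section NerveTheory.
Implicit Types X Y Z : Type.

Lemma nerve_refines X Y (f : X -> Y) W U p s :
  refines f W U p -> nerve W s -> nerve U (map p s).
Proof.
move=> fp [sW [x sx]]; split=> [_ /= /mapP[A As ->]|].
  by have [] := fp _ (sW _ As).
exists (f x) => _ /= /mapP[A As ->].
by have [_] := fp _ (sW _ As); apply; exact: sx.
Qed.

Lemma cocycle_refines X Y (f : X -> Y) W U p n c :
  refines f W U p -> cocycle U n c -> cocycle W n (fun s => c (map p s)).
Proof.
move=> fp cU s Ws ss; rewrite delta_map cU ?size_map//.
exact: nerve_refines fp Ws.
Qed.

Lemma coboundary_refines X Y (f : X -> Y) W U p n c :
  refines f W U p -> coboundary U n c -> coboundary W n (fun s => c (map p s)).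
Proof.
move=> fp [b b0 bU]; exists (fun s => b (map p s)) => // s Ws ss.
rewrite delta_map bU ?size_map//; exact: nerve_refines fp Ws.
Qed.

Lemma coboundary_refines2 X Y (f : X -> Y) W U p q n c :
  refines f W U p -> refines f W U q -> cocycle U n c ->
  coboundary W n (fun s => c (map q s) - c (map p s)).
Proof.
move=> fp fq cU; exists (prism p q c) => // s [sW [x sx]] ss.
rewrite -prismP (prism_eq0 (c := delta c)) ?addr0// => t st tsub.
apply: cU; last by rewrite st ss.
split=> [B /= /tsub|].
  by rewrite mem_cat => /orP[] /mapP[A /sW WA ->]; [case: (fp _ WA)|case: (fq _ WA)].
exists (f x) => B /= /tsub; rewrite mem_cat => /orP[] /mapP[A As ->];
  have Ax := sx _ As.
- by have [_] := fp _ (sW _ As); apply.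
- by have [_] := fq _ (sW _ As); apply.
Qed.

Lemma coboundary0 X (U : set (set X)) n : coboundary U n (fun=> 0).
Proof.
exists (fun=> 0) => // s _ _; rewrite /delta big1// => i _; exact: mulr0.
Qed.

Lemma coboundaryD X (U : set (set X)) n c d :
  coboundary U n c -> coboundary U n d -> coboundary U n (c \+ d).
Proof.
move=> [b b0 bc] [e e0 ed]; exists (b \+ e) => [|s Us ss] /=.
  by rewrite b0 e0.
by rewrite deltaD bc ?ed.
Qed.

Lemma coboundaryN X (U : set (set X)) n c :
  coboundary U n c -> coboundary U n (\- c).
Proof.
move=> [b b0 bc]; exists (\- b) => [|s Us ss] /=; first by rewrite b0 oppr0.
by rewrite deltaN bc.
Qed.

Lemma eq_coboundary X (U : set (set X)) n c d :
  c =1 d -> coboundary U n c -> coboundary U n d.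
Proof. by move=> /funext ->. Qed.

Lemma cocycle0 X (U : set (set X)) n : cocycle U n (fun=> 0).
Proof. by move=> s _ _; rewrite /delta big1// => i _; exact: mulr0. Qed.

Lemma cocycleD X (U : set (set X)) n c d :
  cocycle U n c -> cocycle U n d -> cocycle U n (c \+ d).
Proof. by move=> cU dU s Us ss; rewrite deltaD /= cU ?dU. Qed.

Lemma cocycleN X (U : set (set X)) n c : cocycle U n c -> cocycle U n (\- c).
Proof. by move=> cU s Us ss; rewrite deltaN /= cU ?oppr0. Qed.

Lemma refines_comp X Y Z (f : X -> Y) (g : Y -> Z) W U V p q :
  refines f W U p -> refines g U V q -> refines (g \o f) W V (q \o p).
Proof.
move=> fp gq A /fp[/gq[Vq sub] Asub]; split=> // x Ax.
by apply: sub; exact: Asub.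
Qed.

Lemma refines_id X (U : set (set X)) : refines idfun U U idfun.
Proof. by move=> A UA; split. Qed.

End NerveTheory.

(** A refinement map along [f]: some member of [U] containing the image of the
    given set, if there is one. *)
Definition choose_over (X Y : Type) (f : X -> Y) (U : set (set Y)) (A : set X) :
    set Y :=
  xget setT [set B | U B /\ A `<=` f @^-1` B].

Lemma choose_overP (X Y : Type) (f : X -> Y) W U :
  (forall A, W A -> exists2 B, U B & A `<=` f @^-1` B) ->
  refines f W U (choose_over f U).
Proof.
move=> h A /h[B UB AB].
by rewrite /choose_over; case: xgetP => [C _ //|/(_ B)]; case.
Qed.

Definition pull_cover (X Y : Type) (f : X -> Y) (U : set (set Y)) :
  set (set X) := [set f @^-1` B | B in U].

Definition meet_cover (X : Type) (U V : set (set X)) : set (set X) :=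
  [set A `&` B | A in U & B in V].

Lemma pull_cover_open (X Y : topologicalType) (f : continuousType X Y) U :
  open_cover U -> open_cover (pull_cover f U).
Proof.
move=> [Uo Uc]; split=> [_ [B /Uo oB <-]|].
  by apply: open_comp => // x _; exact: cts_fun.
rewrite -subTset => x _; have : (\bigcup_(A in U) A) (f x) by rewrite Uc.
by move=> [B UB Bfx]; exists (f @^-1` B) => //; exists B.
Qed.

Lemma pull_cover_refines (X Y : Type) (f : X -> Y) U :
  refines f (pull_cover f U) U (choose_over f U).
Proof. by apply: choose_overP => _ [B UB <-]; exists B. Qed.

Lemma meet_cover_open (X : topologicalType) (U V : set (set X)) :
  open_cover U -> open_cover V -> open_cover (meet_cover U V).
Proof.
move=> [Uo Uc] [Vo Vc]; split=> [_ [A /Uo oA [B /Vo oB <-]]|].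
  exact: openI.
rewrite -subTset => x _.
have : (\bigcup_(A in U) A) x by rewrite Uc.
have : (\bigcup_(A in V) A) x by rewrite Vc.
move=> [B VB Bx] [A UA Ax]; exists (A `&` B) => //.
by exists A => //; exists B.
Qed.

Lemma meet_cover_refinesl (X : Type) (U V : set (set X)) :
  refines idfun (meet_cover U V) U (choose_over idfun U).
Proof. by apply: choose_overP => _ [A UA [B VB <-]]; exists A => // x []. Qed.

Lemma meet_cover_refinesr (X : Type) (U V : set (set X)) :
  refines idfun (meet_cover U V) V (choose_over idfun V).
Proof. by apply: choose_overP => _ [A UA [B VB <-]]; exists B => // x []. Qed.

Record cech_rep (n : nat) (X : topologicalType) := CechRep {
  rep_cover : set (set X);
  rep_cochain : seq (set X) -> int;
  rep_open : open_cover rep_cover;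
  rep_cocycle : cocycle rep_cover n rep_cochain
}.

Arguments rep_cocycle {n X} c.
Arguments cocycle0 {X} U n.

HB.instance Definition _ n X := gen_eqMixin (cech_rep n X).
HB.instance Definition _ n X := gen_choiceMixin (cech_rep n X).

Section CechGroup.
Variables (n : nat) (X : topologicalType).
Implicit Types (r : cech_rep n X) (U V W : set (set X)).

(** Equality in the direct limit: the two cocycles become cohomologous on a
    common refinement. *)
Definition cech_equiv r1 r2 : Prop :=
  exists W p1 p2, [/\ open_cover W,
    refines idfun W (rep_cover r1) p1,
    refines idfun W (rep_cover r2) p2 &
    coboundary W n
      (fun s => rep_cochain r1 (map p1 s) - rep_cochain r2 (map p2 s))].

Lemma cech_equiv_refl r : cech_equiv r r.
Proof.
exists (rep_cover r), idfun, idfun; split; [exact: rep_open|..];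
  try exact: refines_id.
by apply: eq_coboundary (coboundary0 _ _) => s; rewrite subrr.
Qed.

Lemma cech_equiv_sym r1 r2 : cech_equiv r1 r2 -> cech_equiv r2 r1.
Proof.
move=> [W [p1 [p2 [oW r1p r2p b]]]]; exists W, p2, p1; split=> //.
by apply: eq_coboundary (coboundaryN b) => s /=; rewrite opprB.
Qed.

Lemma cech_equiv_trans r1 r2 r3 :
  cech_equiv r1 r2 -> cech_equiv r2 r3 -> cech_equiv r1 r3.
Proof.
move=> [W1 [p1 [p2 [oW1 rp1 rp2 b12]]]] [W2 [q2 [q3 [oW2 rq2 rq3 b23]]]].
set W := meet_cover W1 W2.
have l := meet_cover_refinesl (U := W1) (V := W2).
have r := meet_cover_refinesr (U := W1) (V := W2).
exists W, (p1 \o choose_over idfun W1), (q3 \o choose_over idfun W2).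
split; [exact: meet_cover_open|exact: refines_comp l rp1|
  exact: refines_comp r rq3|].
have b1 := coboundary_refines l b12; have b2 := coboundary_refines r b23.
have b3 := coboundary_refines2 (refines_comp r rq2) (refines_comp l rp2)
  (rep_cocycle r2).
apply: eq_coboundary (coboundaryD (coboundaryD b1 b2) b3) => s /=.
by rewrite -!map_comp; ring.
Qed.

Definition cech_eqb : rel (cech_rep n X) := fun r1 r2 => `[< cech_equiv r1 r2 >].

Lemma cech_eqb_refl : reflexive cech_eqb.
Proof. by move=> r; apply/asboolP; exact: cech_equiv_refl. Qed.

Lemma cech_eqb_sym : symmetric cech_eqb.
Proof. by move=> r1 r2; apply/asboolP/asboolP; exact: cech_equiv_sym. Qed.

Lemma cech_eqb_trans : transitive cech_eqb.
Proof.
by move=> r2 r1 r3 /asboolP h /asboolP h'; apply/asboolP; exact: cech_equiv_trans h h'.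
Qed.

Canonical cech_eqrel := EquivRel cech_eqb cech_eqb_refl cech_eqb_sym cech_eqb_trans.

Definition cech := {eq_quot cech_eqrel}.

HB.instance Definition _ := Choice.on cech.

Definition cech_class r : cech := \pi_cech r.

Lemma cech_classP r1 r2 : cech_class r1 = cech_class r2 <-> cech_equiv r1 r2.
Proof.
split=> [/eqquotP/asboolP //|h]; by apply/eqquotP/asboolP.
Qed.

Lemma cech_class_repr (x : cech) : cech_class (repr x) = x.
Proof. exact: reprK. Qed.

Lemma cech_class_refines U W p c (oU : open_cover U) (oW : open_cover W)
    (cU : cocycle U n c) (cW : cocycle W n (fun s => c (map p s))) :
  refines idfun W U p -> cech_class (CechRep oU cU) = cech_class (CechRep oW cW).
Proof.
move=> rp; apply/cech_classP; exists W, p, idfun; split=> //.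
  exact: refines_id.
by apply: eq_coboundary (coboundary0 _ _) => s /=; rewrite map_id subrr.
Qed.

Lemma cech_common2 (x y : cech) : exists W (oW : open_cover W) c d
    (cW : cocycle W n c) (dW : cocycle W n d),
  x = cech_class (CechRep oW cW) /\ y = cech_class (CechRep oW dW).
Proof.
rewrite -(cech_class_repr x) -(cech_class_repr y).
case: (repr x) (repr y) => U c oU cU [V d oV dV].
have l := meet_cover_refinesl (U := U) (V := V).
have r := meet_cover_refinesr (U := U) (V := V).
exists (meet_cover U V), (meet_cover_open oU oV), _, _,
  (cocycle_refines l cU), (cocycle_refines r dV).
by split; exact: cech_class_refines.
Qed.

Lemma cech_common3 (x y z : cech) : exists W (oW : open_cover W) c d e
    (cW : cocycle W n c) (dW : cocycle W n d) (eW : cocycle W n e),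
  [/\ x = cech_class (CechRep oW cW), y = cech_class (CechRep oW dW) &
      z = cech_class (CechRep oW eW)].
Proof.
have [U [oU [c [d [cU [dU [-> ->]]]]]]] := cech_common2 x y.
rewrite -(cech_class_repr z); case: (repr z) => V e oV eV.
have l := meet_cover_refinesl (U := U) (V := V).
have r := meet_cover_refinesr (U := U) (V := V).
exists (meet_cover U V), (meet_cover_open oU oV), _, _, _,
  (cocycle_refines l cU), (cocycle_refines l dU), (cocycle_refines r eV).
by split; exact: cech_class_refines.
Qed.

Definition rep_zero : cech_rep n X.
Proof.
refine (@CechRep n X [set setT] (fun=> 0) _ (cocycle0 _ _)).
by split=> [_ ->|]; [exact: openT|rewrite bigcup_set1].
Defined.

Definition rep_opp r : cech_rep n X :=
  CechRep (rep_open r) (cocycleN (rep_cocycle r)).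

Definition rep_add r1 r2 : cech_rep n X :=
  CechRep (meet_cover_open (rep_open r1) (rep_open r2))
    (cocycleD
      (cocycle_refines (meet_cover_refinesl (U := rep_cover r1) (V := rep_cover r2))
        (rep_cocycle r1))
      (cocycle_refines (meet_cover_refinesr (U := rep_cover r1) (V := rep_cover r2))
        (rep_cocycle r2))).

Definition cech_zero : cech := cech_class rep_zero.
Definition cech_opp (x : cech) : cech := cech_class (rep_opp (repr x)).
Definition cech_add (x y : cech) : cech :=
  cech_class (rep_add (repr x) (repr y)).

Lemma cech_equiv_repr r : cech_equiv (repr (cech_class r)) r.
Proof. by apply/cech_classP; rewrite cech_class_repr. Qed.

Lemma cech_zeroE U (oU : open_cover U) (cU : cocycle U n (fun=> 0)) :
  cech_zero = cech_class (CechRep oU cU).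
Proof.
apply/cech_classP; exists U, (fun=> setT), idfun; split=> //=.
- exact: refines_id.
- by apply: eq_coboundary (coboundary0 _ _) => s /=; rewrite subrr.
Qed.

Lemma cech_oppE U c (oU : open_cover U) (cU : cocycle U n c)
    (cU' : cocycle U n (\- c)) :
  cech_opp (cech_class (CechRep oU cU)) = cech_class (CechRep oU cU').
Proof.
apply/cech_classP.
have [W [p [q [oW rp rq b]]]] := cech_equiv_repr (CechRep oU cU).
exists W, p, q; split=> //.
by apply: eq_coboundary (coboundaryN b) => s /=; rewrite opprB opprK addrC.
Qed.

Lemma cech_addE U c d (oU : open_cover U) (cU : cocycle U n c)
    (dU : cocycle U n d) (cdU : cocycle U n (c \+ d)) :
  cech_add (cech_class (CechRep oU cU)) (cech_class (CechRep oU dU)) =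
  cech_class (CechRep oU cdU).
Proof.
apply/cech_classP.
have := cech_equiv_repr (CechRep oU cU); have := cech_equiv_repr (CechRep oU dU).
move: (repr _) (repr _) => r1 r2.
move=> [W2 [p2 [q2 [oW2 rp2 rq2 b2]]]] [W1 [p1 [q1 [oW1 rp1 rq1 b1]]]].
have l := meet_cover_refinesl (U := W1) (V := W2).
have r := meet_cover_refinesr (U := W1) (V := W2).
set W := meet_cover W1 W2 in l r *.
set a := choose_over idfun W1 in l; set b := choose_over idfun W2 in r.
have pi : refines idfun W (meet_cover (rep_cover r1) (rep_cover r2))
    (choose_over idfun (meet_cover (rep_cover r1) (rep_cover r2))).
  apply: choose_overP => A WA.
  have [W1a Aa] := l _ WA; have [W2b Ab] := r _ WA.
  have [Up1 sp1] := rp1 _ W1a; have [Up2 sp2] := rp2 _ W2b.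
  exists (p1 (a A) `&` p2 (b A)); last first.
    by move=> x Ax; split; [exact/sp1/Aa|exact/sp2/Ab].
  by exists (p1 (a A)); [exact: Up1|exists (p2 (b A)); [exact: Up2|]].
exists W, (choose_over idfun (meet_cover (rep_cover r1) (rep_cover r2))), (q1 \o a).
split; [exact: meet_cover_open|exact: pi|exact: refines_comp l rq1|].
have e1 := coboundary_refines2 (refines_comp l rp1)
  (refines_comp pi (@meet_cover_refinesl _ _ _)) (rep_cocycle r1).
have e2 := coboundary_refines2 (refines_comp r rp2)
  (refines_comp pi (@meet_cover_refinesr _ _ _)) (rep_cocycle r2).
have e3 := coboundary_refines l b1.
have e4 := coboundary_refines r b2.
have e5 := coboundary_refines2 (refines_comp l rq1) (refines_comp r rq2) dU.
apply: eq_coboundary (coboundaryD (coboundaryD (coboundaryD e1 e2)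
  (coboundaryD e3 e4)) e5) => s /=.
by rewrite -!map_comp; ring.
Qed.

Lemma eq_cech_class U c d (oU : open_cover U) (cU : cocycle U n c)
    (dU : cocycle U n d) :
  c =1 d -> cech_class (CechRep oU cU) = cech_class (CechRep oU dU).
Proof.
move=> /funext cd; move: cU; rewrite cd => cU.
by rewrite (Prop_irrelevance cU dU).
Qed.

Lemma cech_addA : associative cech_add.
Proof.
move=> x y z; have [W [oW [c [d [e [cW [dW [eW [-> -> ->]]]]]]]]] := cech_common3 x y z.
rewrite (cech_addE oW dW eW (cocycleD dW eW)).
rewrite (cech_addE oW cW _ (cocycleD cW (cocycleD dW eW))).
rewrite (cech_addE oW cW dW (cocycleD cW dW)).
rewrite (cech_addE oW _ eW (cocycleD (cocycleD cW dW) eW)).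
by apply: eq_cech_class => s /=; rewrite addrA.
Qed.

Lemma cech_addC : commutative cech_add.
Proof.
move=> x y; have [W [oW [c [d [cW [dW [-> ->]]]]]]] := cech_common2 x y.
rewrite (cech_addE oW cW dW (cocycleD cW dW)).
rewrite (cech_addE oW dW cW (cocycleD dW cW)).
by apply: eq_cech_class => s /=; rewrite addrC.
Qed.

Lemma cech_add0 : left_id cech_zero cech_add.
Proof.
move=> x; rewrite -(cech_class_repr x); case: (repr x) => U c oU cU.
rewrite (cech_zeroE oU (cocycle0 _ _)).
rewrite (cech_addE oU _ cU (cocycleD (cocycle0 U n) cU)).
by apply: eq_cech_class => s /=; rewrite add0r.
Qed.

Lemma cech_addN : left_inverse cech_zero cech_opp cech_add.
Proof.
move=> x; rewrite -(cech_class_repr x); case: (repr x) => U c oU cU.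
rewrite (cech_zeroE oU (cocycle0 _ _)) (cech_oppE oU cU (cocycleN cU)).
rewrite (cech_addE oU _ cU (cocycleD (cocycleN cU) cU)).
by apply: eq_cech_class => s /=; rewrite addNr.
Qed.

HB.instance Definition _ :=
  GRing.isZmodule.Build cech cech_addA cech_addC cech_add0 cech_addN.

End CechGroup.

Section CechMap.
Variable n : nat.

Definition rep_pull (X Y : topologicalType) (f : continuousType X Y)
    (r : cech_rep n Y) : cech_rep n X :=
  CechRep (pull_cover_open f (rep_open r))
    (cocycle_refines (pull_cover_refines (f := f) (U := rep_cover r))
      (rep_cocycle r)).

Definition cech_map (X Y : topologicalType) (f : continuousType X Y)
    (y : cech n Y) : cech n X := cech_class (rep_pull f (repr y)).

Lemma cech_mapE (X Y : topologicalType) (f : continuousType X Y) U W p c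
    (oU : open_cover U) (oW : open_cover W) (cU : cocycle U n c)
    (cW : cocycle W n (fun s => c (map p s))) :
  refines f W U p ->
  cech_map f (cech_class (CechRep oU cU)) = cech_class (CechRep oW cW).
Proof.
move=> rp; apply/cech_classP.
have := cech_equiv_repr (CechRep oU cU).
move: (repr _) => r1 [V [p1 [p2 [oV rp1 rp2 b]]]].
set P := pull_cover f V; have fP : refines f P V _ := @pull_cover_refines _ _ f _.
have l := meet_cover_refinesl (U := P) (V := W).
have r := meet_cover_refinesr (U := P) (V := W).
set M := meet_cover P W in l r *.
have oM : open_cover M by apply: meet_cover_open => //; exact: pull_cover_open.
set g := choose_over f V in fP.
set a := choose_over idfun P in l; set b' := choose_over idfun W in r.
have pi : refines idfun M (pull_cover f (rep_cover r1))
    (choose_over idfun (pull_cover f (rep_cover r1))).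
  apply: choose_overP => A MA.
  have [Pa Aa] := l _ MA; have [Vg ga] := fP _ Pa.
  have [Up sp] := rp1 _ Vg.
  exists (f @^-1` p1 (g (a A))); first by exists (p1 (g (a A))).
  by move=> x Ax; apply/sp/ga/Aa.
exists M, (choose_over idfun (pull_cover f (rep_cover r1))), b'; split=> //.
have fl : refines f M V (g \o a) := refines_comp l fP.
have e1 := coboundary_refines2 (refines_comp fl rp1 : refines f M _ _)
  (refines_comp pi (@pull_cover_refines _ _ f _) : refines f M _ _)
  (rep_cocycle r1).
have e2 := coboundary_refines fl b.
have e3 := coboundary_refines2 (refines_comp r rp : refines f M _ _)
  (refines_comp fl rp2 : refines f M _ _) cU.
apply: eq_coboundary (coboundaryD (coboundaryD e1 e2) e3) => s /=.
by rewrite -!map_comp; ring.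
Qed.

Lemma cech_map_is_additive (X Y : topologicalType) (f : continuousType X Y) :
  nmod_morphism (cech_map f).
Proof.
split=> [|x y].
  rewrite /GRing.zero /= (cech_zeroE (rep_open (rep_zero n Y)) (cocycle0 _ _)).
  have oP := pull_cover_open f (rep_open (rep_zero n Y)).
  rewrite (cech_mapE _ oP _ (cocycle0 _ _) (pull_cover_refines (f := f) (U := _))).
  exact/esym/cech_zeroE.
have [W [oW [c [d [cW [dW [-> ->]]]]]]] := cech_common2 x y.
rewrite /GRing.add /= (cech_addE oW cW dW (cocycleD cW dW)).
have fW := pull_cover_refines (f := f) (U := W).
have cP := cocycle_refines fW cW; have dP := cocycle_refines fW dW.
have oP := pull_cover_open f oW.
rewrite (cech_mapE oW oP _ cP fW) (cech_mapE oW oP _ dP fW).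
by rewrite (cech_mapE oW oP _ (cocycleD cP dP) fW) (cech_addE oP cP dP (cocycleD cP dP)).
Qed.

HB.instance Definition _ (X Y : topologicalType) (f : continuousType X Y) :=
  GRing.isNmodMorphism.Build (cech n Y) (cech n X) (cech_map f)
    (cech_map_is_additive f).

Lemma cech_map_id (X : topologicalType) (f : continuousType X X) :
  f =1 idfun -> cech_map f =1 idfun.
Proof.
move=> /funext fid x; rewrite -(cech_class_repr x); case: (repr x) => U c oU cU.
have cU' : cocycle U n (fun s => c (map idfun s)).
  by move: cU; congr cocycle; apply/funext => s; rewrite map_id.
rewrite (cech_mapE (p := idfun) oU oU _ cU'); last first.
  by rewrite fid; exact: refines_id.
by apply: eq_cech_class => s; rewrite map_id.
Qed.

Lemma cech_map_comp (X Y Z : topologicalType) (f : continuousType X Y)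
    (g : continuousType Y Z) (h : continuousType X Z) :
  h =1 g \o f -> cech_map h =1 cech_map f \o cech_map g.
Proof.
move=> /funext hgf x; rewrite -(cech_class_repr x); case: (repr x) => U c oU cU.
have gU := pull_cover_refines (f := g) (U := U).
have fU := pull_cover_refines (f := f) (U := pull_cover g U).
have cg := cocycle_refines gU cU.
have cf := cocycle_refines fU cg.
have og := pull_cover_open g oU; have of_ := pull_cover_open f og.
rewrite /= (cech_mapE oU og cU cg gU) (cech_mapE og of_ cg cf fU).
have ch : cocycle (pull_cover f (pull_cover g U)) n
    (fun s => c (map (choose_over g U \o choose_over f (pull_cover g U)) s)).
  by move: cf; congr cocycle; apply/funext => s; rewrite map_comp.
rewrite (cech_mapE oU of_ cU ch); last first.
  by rewrite hgf; exact: refines_comp fU gU.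
by apply: eq_cech_class => s; rewrite map_comp.
Qed.

End CechMap.

(** The index set is ordered and the arrows are contravariant: they go from the
    groups at the larger index to those at the smaller one. *)

Record group_diagram := GroupDiagram {
  dg_index : Type;
  dg_le : dg_index -> dg_index -> Prop;
  dg_group : dg_index -> nat -> zmodType;
  dg_arrow : forall i j, dg_le i j ->
    forall n, {additive dg_group j n -> dg_group i n}
}.

Definition diagram_iso (D E : group_diagram) : Prop :=
  exists f : dg_index D -> dg_index E,
  [/\ bijective f,
      forall i j, dg_le i j <-> dg_le (f i) (f j) &
      exists g : forall i n, {additive dg_group i n -> dg_group (f i) n},
        (forall i n, bijective (g i n)) /\
        forall i j (le_ij : dg_le i j) (le_fij : dg_le (f i) (f j)) n x,
          g i n (dg_arrow le_ij n x) = dg_arrow le_fij n (g j n x)].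

Definition group_iso (G H : zmodType) : Prop :=
  exists f : {additive G -> H}, bijective f.

Definition cech_iso (X Y : topologicalType) : Prop :=
  forall n, group_iso (cech n X) (cech n Y).

Section InclusionMap.
Variables (X : topologicalType) (L M : set X).

Definition incl (LM : L `<=` M) (x : L) : M :=
  exist _ (val x) (mem_set (LM _ (set_mem (valP x)))).

Lemma incl_continuous (LM : L `<=` M) : continuous (incl LM).
Proof.
apply/continuousP => _ [B oB <-].
by exists B.
Qed.

Definition incl_map (LM : L `<=` M) : continuousType L M :=
  mkcts (@incl_continuous LM).

End InclusionMap.

(** For [L = set0] the relation is equality, so [collapse set0] is [X]. *)
Section Collapse.
Variables (X : topologicalType) (L : set X).

Definition collapse_rel : rel X := fun x y => `[< x = y \/ L x /\ L y >].

Lemma collapse_refl : reflexive collapse_rel.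
Proof. by move=> x; apply/asboolP; left. Qed.

Lemma collapse_sym : symmetric collapse_rel.
Proof.
by move=> x y; apply/asboolP/asboolP => -[->|[]]; by [left|right].
Qed.

Lemma collapse_trans : transitive collapse_rel.
Proof.
move=> y x z /asboolP[->//|[Lx Ly]] /asboolP[<-|[_ Lz]]; apply/asboolP;
  by right.
Qed.

Canonical collapse_equiv :=
  EquivRel collapse_rel collapse_refl collapse_sym collapse_trans.

Definition collapse : topologicalType :=
  quotient_topology {eq_quot collapse_equiv}.

Definition collapse_pi (x : X) : collapse := \pi_{eq_quot collapse_equiv} x.

End Collapse.

Section CollapseMap.
Variables (X : topologicalType) (L M : set X).

Definition collapse_fun (x : collapse L) : collapse M :=
  collapse_pi M (repr (x : {eq_quot collapse_equiv L})).

Lemma collapse_funE : L `<=` M ->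
  forall x, collapse_fun (collapse_pi L x) = collapse_pi M x.
Proof.
move=> LM x; apply/eqquotP/asboolP.
have /eqquotP/asboolP : repr (collapse_pi L x : {eq_quot collapse_equiv L}) =
  x %[mod {eq_quot collapse_equiv L}] by rewrite reprK.
by case=> [->|[/LM Mx /LM My]]; [left|right].
Qed.

Lemma collapse_continuous : L `<=` M -> continuous collapse_fun.
Proof.
move=> LM; apply/quotient_continuous.
have -> : collapse_fun \o \pi_(quotient_topology {eq_quot collapse_equiv L}) =
  collapse_pi M by apply/funext => x; exact: collapse_funE.
exact: pi_continuous.
Qed.

Definition collapse_map (LM : L `<=` M) :
    continuousType (collapse L) (collapse M) :=
  mkcts (collapse_continuous LM).

End CollapseMap.

Record substitution (A : finType) := Substitution {
  subst_fun :> A -> seq A;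
  subst_neq0 : forall a, subst_fun a != [::]
}.

Section TilingSpace.
Variables (R : realType) (A : finType) (phi : substitution A).

Definition subst_word (s : seq A) : seq A := flatten (map phi s).

(** The word [w_i w_(i+1) ... w_(i+l-1)]. *)
Definition subword (w : int -> A) (i : int) (l : nat) : seq A :=
  mkseq (fun k => w (i + k%:Z)) l.

Definition full_shift := {ptws int -> discrete_topology A}.

Definition subst_shift : set full_shift :=
  [set w | forall i l, exists a k,
    infix (subword w i l) (iter k subst_word [:: a])].

(** The [k]-th iterate of the shift [w |-> (w_(i+1))_i], for [k : int]. *)
Definition shift_iter (k : int) (w : full_shift) : full_shift :=
  fun i => w (i + k).

Lemma shift_iter_stable k w : subst_shift w -> subst_shift (shift_iter k w).
Proof.
move=> Xw i l; have [a [m h]] := Xw (i + k) l; exists a, m.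
move: h; congr (is_true (infix _ _)); apply: eq_map => j.
by rewrite /shift_iter addrAC.
Qed.

Definition sigma (k : int) (w : subst_shift) : subst_shift :=
  exist _ (shift_iter k (val w))
    (mem_set (shift_iter_stable k (set_mem (valP w)))).

Definition unit_itv : set R := `[0, 1].

Lemma unit_itv0 : 0 \in unit_itv.
Proof. by rewrite mem_set// /unit_itv /= in_itv /= lexx ler01. Qed.

Lemma unit_itv1 : 1 \in unit_itv.
Proof. by rewrite mem_set// /unit_itv /= in_itv /= lexx ler01. Qed.

Definition frac (t : R) : R := t - (Num.floor t)%:~R.

Lemma frac_itv t : frac t \in unit_itv.
Proof.
rewrite mem_set// /unit_itv /= in_itv /= /frac subr_ge0 floor_le /=.
by rewrite lerBlDl -intrD1 ltW// floorD1_gt.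
Qed.

Definition suspension := (subst_shift * unit_itv)%type.

Definition glue (x y : suspension) : Prop :=
  exists w, x = (w, exist _ 1 unit_itv1) /\ y = (sigma 1 w, exist _ 0 unit_itv0).

Definition glue_rel : rel suspension :=
  fun x y => `[< clos_refl_sym_trans _ glue x y >].

Lemma glue_refl : reflexive glue_rel.
Proof. by move=> x; apply/asboolP; exact: rst_refl. Qed.

Lemma glue_sym : symmetric glue_rel.
Proof. by move=> x y; apply/asboolP/asboolP; exact: rst_sym. Qed.

Lemma glue_trans : transitive glue_rel.
Proof.
by move=> y x z /asboolP h /asboolP h'; apply/asboolP; exact: rst_trans h h'.
Qed.

Canonical glue_equiv := EquivRel glue_rel glue_refl glue_sym glue_trans.

Definition tiling_space : topologicalType :=
  quotient_topology {eq_quot glue_equiv}.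

Definition tiling_pi (x : suspension) : tiling_space :=
  \pi_{eq_quot glue_equiv} x.

Definition susp_flow (tau : R) (x : suspension) : suspension :=
  (sigma (Num.floor (val x.2 + tau)) x.1,
   exist _ (frac (val x.2 + tau)) (frac_itv (val x.2 + tau))).

Definition rho (tau : R) (x : tiling_space) : tiling_space :=
  tiling_pi (susp_flow tau (repr (x : {eq_quot glue_equiv}))).

Lemma rhoE tau (x : suspension) :
  rho tau (tiling_pi x) = tiling_pi (susp_flow tau x).
Proof.
have flow_glue y z : glue y z -> susp_flow tau y = susp_flow tau z.
  move=> [w [-> ->]]; rewrite /susp_flow /= add0r.
  have E : Num.floor (1 + tau) = 1 + Num.floor tau.
    by rewrite addrC floorDrz ?int_num1// floor1 addrC.
  congr (_, _).
    by apply/val_inj/funext => i; rewrite /= /shift_iter E addrA addrAC.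
  by apply/val_inj; rewrite /= /frac E intrD; ring.
have /eqquotP/asboolP : repr (tiling_pi x : {eq_quot glue_equiv}) =
  x %[mod {eq_quot glue_equiv}] by rewrite reprK.
rewrite /rho; move: (repr _) => y yx; congr tiling_pi.
by elim: yx => {x y} // x y z _ -> _ ->.
Qed.

Definition orbit (x : tiling_space) : set tiling_space :=
  [set rho tau x | tau in setT].

Record cis := Cis {
  cis_set :> set tiling_space;
  cis_closed : closed cis_set;
  cis_invariant : forall tau, rho tau @` cis_set = cis_set
}.

Definition inclusion_cohomology : group_diagram :=
  @GroupDiagram cis (fun L M => L `<=` M)
    (fun L n => cech n (L : set tiling_space))
    (fun L M LM n => cech_map (incl_map LM)).

Definition quotient_cohomology : group_diagram :=
  @GroupDiagram cis (fun L M => L `<=` M)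
    (fun L n => cech n (collapse L))
    (fun L M LM n => cech_map (collapse_map LM)).

End TilingSpace.

Definition orbit_equivalent (R : realType) (A A' : finType)
    (phi : substitution A) (phi' : substitution A') : Prop :=
  exists (h : tiling_space R phi -> tiling_space R phi')
         (k : tiling_space R phi' -> tiling_space R phi),
  [/\ continuous h, continuous k, cancel h k, cancel k h &
      forall x, h @` orbit x = orbit (h x)].

(* Main.v *)
Require Import Defs.
From Stdlib Require Import Relation_Operators.
From mathcomp Require Import all_boot all_order all_algebra.
From mathcomp Require Import all_classical all_reals all_analysis.
From mathcomp Require Import generic_quotient ring.

Import Order.TTheory GRing.Theory Num.Theory Defs.

Set Implicit Arguments.
Unset Strict Implicit.
Unset Printing Implicit Defensive.

Local Open Scope classical_set_scope.
Local Open Scope quotient_scope.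
Local Open Scope ring_scope.

(** The theorem is a matter of functoriality. An orbit equivalence [h] carries
    closed invariant subspaces to closed invariant subspaces: an invariant set
    is the same thing as a union of orbits, and [h] preserves orbits. So
    [L |-> h @` L] is an isomorphism of the lattices of closed invariant
    subspaces. The homeomorphism restricts to [L -> h @` L] and descends to
    [collapse L -> collapse (h @` L)]; both families commute with the inclusions
    and with the quotient maps already at the level of spaces, and hence, by
    functoriality, on cohomology.

    Conversely, the cohomology of the whole space is one of the groups of either
    diagram, at a place that any order isomorphism must respect: the tiling space
    is (homeomorphic to) the largest object of the inclusion diagram, and it is
    the collapse of the smallest closed invariant subspace, the empty one.

    That the images [h @` L] and the whole space are closed invariant subspaces
    depends on [rho] being a group action ([rho_comp], [rho0]): the definition asks for
    [rho tau @` L = L] and not only for an inclusion. *)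

(** * Functoriality of Čech cohomology *)

Lemma cech_map_cancel n (X Y : topologicalType) (f : continuousType X Y)
    (g : continuousType Y X) :
  cancel f g -> cancel (@cech_map n _ _ g) (@cech_map n _ _ f).
Proof.
move=> fK x.
have idc : continuous (@idfun X) by move=> y; exact: cvg_id.
have e : mkcts idc =1 g \o f by move=> y /=; rewrite fK.
by rewrite -[LHS](cech_map_comp e) cech_map_id.
Qed.

Lemma cech_map_bij n (X Y : topologicalType) (f : continuousType X Y)
    (g : continuousType Y X) :
  cancel f g -> cancel g f -> bijective (@cech_map n _ _ f).
Proof. by move=> fK gK; exists (@cech_map n _ _ g); exact: cech_map_cancel. Qed.

(** All the naturality squares of diagram isomorphisms below are obtained from
    commuting squares of spaces. *)
Lemma cech_map_square n (X Y Z T : topologicalType) (f : continuousType X Y)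
    (g : continuousType Y T) (f' : continuousType X Z) (g' : continuousType Z T) :
  g \o f =1 g' \o f' ->
  @cech_map n _ _ f \o @cech_map n _ _ g =1
  @cech_map n _ _ f' \o @cech_map n _ _ g'.
Proof.
move=> e x.
have gfc : continuous (g \o f).
  by move=> y; apply: continuous_comp; exact: cts_fun.
by rewrite -(cech_map_comp (h := mkcts gfc) (f := f) (g := g))//;
  exact: cech_map_comp.
Qed.

(** * Maps of subspaces and of collapsed spaces *)

Section SubMap.
Variables (X Y : topologicalType) (f : X -> Y) (L : set X) (M : set Y).
Hypothesis fLM : forall x, L x -> M (f x).

Definition sub_fun (x : L) : M :=
  exist _ (f (val x)) (mem_set (fLM (set_mem (valP x)))).

Lemma sub_fun_continuous : continuous f -> continuous sub_fun.
Proof.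
move=> fc; apply/continuousP => _ [B oB <-].
exists (f @^-1` B) => //.
by apply: open_comp => // x _; exact: fc.
Qed.

Definition sub_map (fc : continuous f) : continuousType L M :=
  mkcts (sub_fun_continuous fc).

End SubMap.

Lemma collapseP (X : topologicalType) (L : set X) (P : collapse L -> Prop) :
  (forall x, P (collapse_pi L x)) -> forall y, P y.
Proof.
by move=> h y; rewrite -[y](@reprK _ {eq_quot collapse_equiv L}); exact: h.
Qed.

(** A map of pairs [(X, L) -> (Y, M)] descends to the collapsed spaces. *)
Section CollapsedMap.
Variables (X Y : topologicalType) (f : X -> Y) (L : set X) (M : set Y).
Hypothesis fLM : forall x, L x -> M (f x).

Definition collapsed_fun (x : collapse L) : collapse M :=
  collapse_pi M (f (repr (x : {eq_quot collapse_equiv L}))).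

Lemma collapsed_funE x : collapsed_fun (collapse_pi L x) = collapse_pi M (f x).
Proof.
apply/eqquotP/asboolP.
have /eqquotP/asboolP : repr (collapse_pi L x : {eq_quot collapse_equiv L}) =
  x %[mod {eq_quot collapse_equiv L}] by rewrite reprK.
by case=> [->|[/fLM Mx /fLM My]]; [left|right].
Qed.

Lemma collapsed_fun_continuous : continuous f -> continuous collapsed_fun.
Proof.
move=> fc; apply/quotient_continuous.
have -> : collapsed_fun \o \pi_(quotient_topology {eq_quot collapse_equiv L}) =
  collapse_pi M \o f by apply/funext => x; exact: collapsed_funE.
by move=> x; apply: continuous_comp; [exact: fc|exact: pi_continuous].
Qed.

Definition collapsed_map (fc : continuous f) :
    continuousType (collapse L) (collapse M) :=
  mkcts (collapsed_fun_continuous fc).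

End CollapsedMap.

Lemma collapsed_map_can (X Y : topologicalType) (f : X -> Y) (g : Y -> X)
    (L : set X) (M : set Y) (fLM : forall x, L x -> M (f x))
    (gML : forall y, M y -> L (g y)) (fc : continuous f) (gc : continuous g) :
  cancel f g -> cancel (collapsed_map fLM fc) (collapsed_map gML gc).
Proof.
move=> fK; apply: collapseP => x.
rewrite -[LHS]/(collapsed_fun g L (collapsed_fun f M (collapse_pi L x))).
by rewrite (collapsed_funE fLM) (collapsed_funE gML) fK.
Qed.

Lemma collapsed_map_natural (X Y : topologicalType) (f : X -> Y)
    (L M : set X) (L' M' : set Y) (fL : forall x, L x -> L' (f x))
    (fM : forall x, M x -> M' (f x)) (LM : L `<=` M) (LM' : L' `<=` M')
    (fc : continuous f) :
  collapsed_map fM fc \o collapse_map LM =1 collapse_map LM' \o collapsed_map fL fc.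
Proof.
apply: collapseP => x.
rewrite -[LHS]/(collapsed_fun f M' (collapse_fun M (collapse_pi L x))).
rewrite -[RHS]/(collapse_fun M' (collapsed_fun f L' (collapse_pi L x))).
by rewrite collapse_funE// (collapsed_funE fL) (collapsed_funE fM) collapse_funE.
Qed.

Definition homeomorphic (X Y : topologicalType) : Prop :=
  exists (f : continuousType X Y) (g : continuousType Y X),
    cancel f g /\ cancel g f.

(** Both directions come from the same pair of maps, which spares showing that
    the inverse of an additive bijection is additive. *)
Lemma homeomorphic_cech_iso X Y :
  homeomorphic X Y -> cech_iso X Y /\ cech_iso Y X.
Proof.
move=> [f [g [fK gK]]].
split=> n; [exists (@cech_map n _ _ g)|exists (@cech_map n _ _ f)];
  exact: cech_map_bij.
Qed.

Lemma setT_homeomorphic (X : topologicalType) : homeomorphic X [set: X].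
Proof.
pose i (x : X) : [set: X] := exist _ x (mem_set I).
have ic : continuous i by apply/continuousP => _ [B oB <-].
have vc : continuous (val : [set: X] -> X).
  by apply/continuousP => B oB; exists B.
by exists (mkcts ic), (mkcts vc); split=> // x; exact: val_inj.
Qed.

Lemma collapse_set0_homeomorphic (X : topologicalType) :
  homeomorphic X (collapse (@set0 X)).
Proof.
pose r (x : collapse (@set0 X)) : X := repr (x : {eq_quot collapse_equiv set0}).
have rK x : r (collapse_pi set0 x) = x.
  have /eqquotP/asboolP : r (collapse_pi set0 x) =
    x %[mod {eq_quot collapse_equiv set0}] by rewrite /r reprK.
  by case=> // -[].
have rc : continuous r.
  apply/quotient_continuous.
  have -> : r \o \pi_(quotient_topology {eq_quot collapse_equiv set0}) = idfun.
    by apply/funext => x; exact: rK.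
  by move=> x; exact: cvg_id.
have pc : continuous (collapse_pi (@set0 X)) by exact: pi_continuous.
exists (mkcts pc), (mkcts rc); split; first exact: rK.
by apply: collapseP => x; exact: (congr1 (collapse_pi set0) (rK x)).
Qed.

(** * The translation action *)

Section Action.
Variables (R : realType) (A : finType) (phi : substitution A).
Notation Omega := (tiling_space R phi).

Lemma tilingP (P : Omega -> Prop) :
  (forall x, P (tiling_pi x)) -> forall y, P y.
Proof.
by move=> h y; rewrite -[y](@reprK _ {eq_quot glue_equiv R phi}); exact: h.
Qed.

(** On the suspension, before gluing, the additivity is exact: the integer part
    shed by the first translation is absorbed by the shift. *)
Lemma susp_flow_comp s t (x : suspension R phi) :
  susp_flow s (susp_flow t x) = susp_flow (s + t) x.
Proof.
case: x => w u; rewrite /susp_flow /=.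
have e : frac (val u + t) + s = val u + (s + t) - (Num.floor (val u + t))%:~R.
  by rewrite /frac; ring.
have E : Num.floor (frac (val u + t) + s) =
    Num.floor (val u + (s + t)) - Num.floor (val u + t).
  by rewrite e -mulrNz floorDrz ?intr_int// intrKfloor.
congr (_, _).
  by apply/val_inj/funext => i; rewrite /= /shift_iter E addrA subrK.
apply: val_inj; rewrite /= -[LHS]/(_ - (Num.floor _)%:~R) E e intrB opprB.
by rewrite addrA subrK.
Qed.

Lemma rho_comp s t (x : Omega) : rho s (rho t x) = rho (s + t) x.
Proof. by elim/tilingP: x => x; rewrite !rhoE susp_flow_comp. Qed.

(** The flow on the suspension moves the points at height [1] at time [0]; the
    gluing makes up for it. *)
Lemma rho0 (x : Omega) : rho 0 x = x.
Proof.
elim/tilingP: x => -[w u]; rewrite rhoE; apply/eqquotP/asboolP.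
rewrite /susp_flow /= addr0.
have := set_mem (valP u); rewrite /unit_itv /= in_itv /= => /andP[u0].
rewrite le_eqVlt => /orP[/eqP u1|u1].
  apply/rst_sym/rst_step; exists w; split.
    by congr (_, _); exact: val_inj.
  congr (_, _); first by rewrite u1 floor1.
  by apply: val_inj; rewrite /= /frac u1 floor1 subrr.
have F : Num.floor (val u) = 0 by apply/floor_def; rewrite u0 add0r.
rewrite (_ : (_, _) = (w, u)); first exact: rst_refl.
congr (_, _); last by apply: val_inj; rewrite /= /frac F subr0.
by apply/val_inj/funext => i; rewrite /= /shift_iter F addr0.
Qed.

(** The orbit inclusion at [tau] gives one half of the equality, and at [- tau]
    the other. *)
Lemma rho_invariant (L : set Omega) :
  (forall x, L x -> orbit x `<=` L) -> forall tau, rho tau @` L = L.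
Proof.
move=> oL tau; apply/seteqP; split=> [_ [x Lx <-]|x Lx].
  by apply: (oL _ Lx); exists tau.
exists (rho (- tau) x); last by rewrite rho_comp subrr rho0.
by apply: (oL _ Lx); exists (- tau).
Qed.

Lemma cis_orbit (L : cis R phi) x : cis_set L x -> orbit x `<=` L.
Proof.
by move=> Lx _ [tau _ <-]; rewrite -(cis_invariant L tau); exists x.
Qed.

Lemma cis_ext (L M : cis R phi) : L = M :> set Omega -> L = M.
Proof.
case: L M => [L cL iL] [M cM iM] /= LM; subst M.
by congr Cis; exact: Prop_irrelevance.
Qed.

Definition cisT : cis R phi :=
  Cis closedT (rho_invariant (fun _ _ _ _ => I)).

Definition cis0 : cis R phi := Cis closed0 (fun _ => image_set0 _).

End Action.

(** * Orbit equivalence *)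

Lemma image_can X Y (f : X -> Y) (g : Y -> X) (L : set X) :
  cancel f g -> g @` (f @` L) = L.
Proof.
move=> fK; rewrite image_comp.
have -> : g \o f = id by apply/funext => x /=; rewrite fK.
exact: image_id.
Qed.

Section OrbitEquivalence.
Variables (R : realType) (A A' : finType).
Variables (phi : substitution A) (phi' : substitution A').
Variables (h : tiling_space R phi -> tiling_space R phi').
Variables (k : tiling_space R phi' -> tiling_space R phi).
Hypotheses (kc : continuous k) (hK : cancel h k) (kK : cancel k h).
Hypothesis horb : forall x, h @` orbit x = orbit (h x).

(** With this the hypotheses are symmetric in [h] and [k], so that the map of
    closed invariant subspaces built from [k] inverts the one built from [h]. *)
Lemma orbit_inverse y : k @` orbit y = orbit (k y).
Proof. by rewrite -{1}[y]kK -horb image_can. Qed.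

Lemma image_cis_closed (L : cis R phi) : closed (h @` L).
Proof.
rewrite (_ : h @` L = k @^-1` L); last first.
  apply/seteqP; split=> [_ [x Lx <-]|y Ly]; first by rewrite /= hK.
  by exists (k y).
by move/continuous_closedP: kc; apply; exact: cis_closed.
Qed.

Lemma image_cis_invariant (L : cis R phi) tau : rho tau @` (h @` L) = h @` L.
Proof.
apply: rho_invariant => _ [x Lx <-]; rewrite -horb.
by apply: image_subset; exact: cis_orbit.
Qed.

Definition image_cis (L : cis R phi) : cis R phi' :=
  Cis (@image_cis_closed L) (@image_cis_invariant L).

Lemma image_cis_to (L : cis R phi) x : cis_set L x -> cis_set (image_cis L) (h x).
Proof. by move=> Lx; exists x. Qed.

Lemma image_cis_from (L : cis R phi) y : cis_set (image_cis L) y -> cis_set L (k y).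
Proof. by move=> [x Lx <-]; rewrite hK. Qed.

Lemma image_cis_le (L M : cis R phi) :
  L `<=` M <-> image_cis L `<=` image_cis M.
Proof.
split=> [LM|LM x Lx]; first exact: image_subset.
by rewrite -[x]hK; apply/image_cis_from/LM/image_cis_to.
Qed.

End OrbitEquivalence.

Section OrbitEquivalenceDiagrams.
Variables (R : realType) (A A' : finType).
Variables (phi : substitution A) (phi' : substitution A').

Lemma orbit_equivalent_inclusion :
  orbit_equivalent R phi phi' ->
  diagram_iso (inclusion_cohomology R phi) (inclusion_cohomology R phi').
Proof.
move=> [h [k [hc kc hK kK horb]]].
have korb := orbit_inverse hK kK horb.
exists (image_cis kc hK kK horb); split.
- exists (image_cis hc kK hK korb) => L; apply: cis_ext;
  exact: image_can.
- exact: image_cis_le.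
exists (fun L n => @cech_map n _ _ (sub_map (image_cis_from (L := L)) kc)).
split=> [L n|L M LM hLM n x].
  apply: (@cech_map_bij n _ _ _ (sub_map (image_cis_to kc hK kK horb (L := L)) hc)) => y;
  by apply: val_inj; rewrite /= ?hK ?kK.
by apply: cech_map_square => y; exact: val_inj.
Qed.

Lemma orbit_equivalent_quotient :
  orbit_equivalent R phi phi' ->
  diagram_iso (quotient_cohomology R phi) (quotient_cohomology R phi').
Proof.
move=> [h [k [hc kc hK kK horb]]].
have korb := orbit_inverse hK kK horb.
exists (image_cis kc hK kK horb); split.
- exists (image_cis hc kK hK korb) => L; apply: cis_ext;
  exact: image_can.
- exact: image_cis_le.
have from L := image_cis_from (L := L) (kc := kc) (hK := hK) (kK := kK) (horb := horb).
have to L := image_cis_to kc hK kK horb (L := L).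
exists (fun L n => @cech_map n _ _ (collapsed_map (from L) kc)).
split=> [L n|L M LM hLM n x].
  apply: (@cech_map_bij n _ _ _ (collapsed_map (to L) hc));
  exact: collapsed_map_can.
by apply: cech_map_square => y; apply/esym; exact: collapsed_map_natural.
Qed.

End OrbitEquivalenceDiagrams.

(** * Recovering the cohomology of the whole space *)

Section Extrema.
Variables D E : group_diagram.
Hypothesis anti : forall i j : dg_index E, dg_le i j -> dg_le j i -> i = j.

(** An order isomorphism preserves extrema, and antisymmetry of the target makes
    them unique, so that the two groups are matched by the diagram isomorphism. *)
Lemma diagram_iso_max (i : dg_index D) (j : dg_index E) :
  (forall x, dg_le x i) -> (forall y, dg_le y j) ->
  diagram_iso D E -> forall n, group_iso (dg_group i n) (dg_group j n).
Proof.
move=> imax jmax [f [[e fK eK] fle [g [gbij _]]]] n.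
have <- : f i = j; last by exists (g i n).
by apply: anti => //; rewrite -[j]eK -fle.
Qed.

Lemma diagram_iso_min (i : dg_index D) (j : dg_index E) :
  (forall x, dg_le i x) -> (forall y, dg_le j y) ->
  diagram_iso D E -> forall n, group_iso (dg_group i n) (dg_group j n).
Proof.
move=> imin jmin [f [[e fK eK] fle [g [gbij _]]]] n.
have <- : f i = j; last by exists (g i n).
by apply: anti => //; rewrite -[j]eK -fle.
Qed.

End Extrema.

Lemma group_iso_trans (G H K : zmodType) :
  group_iso G H -> group_iso H K -> group_iso G K.
Proof. by move=> [f fb] [g gb]; exists (g \o f); exact: bij_comp. Qed.

Theorem corollary5p12 (R : realType) (A A' : finType)
    (phi : substitution A) (phi' : substitution A') :
  (orbit_equivalent R phi phi' ->
     diagram_iso (inclusion_cohomology R phi) (inclusion_cohomology R phi') /\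
     diagram_iso (quotient_cohomology R phi) (quotient_cohomology R phi')) /\
  (diagram_iso (inclusion_cohomology R phi) (inclusion_cohomology R phi') \/
   diagram_iso (quotient_cohomology R phi) (quotient_cohomology R phi') ->
     cech_iso (tiling_space R phi) (tiling_space R phi')).
Proof.
split=> [oe|].
  by split; [exact: orbit_equivalent_inclusion|exact: orbit_equivalent_quotient].
have anti (L M : cis R phi') : L `<=` M -> M `<=` L -> L = M.
  by move=> LM ML; apply/cis_ext/seteqP.
move=> [] iso n.
- have [to _] := homeomorphic_cech_iso (setT_homeomorphic (tiling_space R phi)).
  have [_ from] :=
    homeomorphic_cech_iso (setT_homeomorphic (tiling_space R phi')).
  apply: group_iso_trans (to n) (group_iso_trans _ (from n)).
  have extr (B : finType) (psi : substitution B) (L : cis R psi) :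
    L `<=` cisT R psi by move=> x _.
  exact: (@diagram_iso_max (inclusion_cohomology R phi)
    (inclusion_cohomology R phi') anti _ _ (extr _ _) (extr _ _) iso n).
- have [to _] :=
    homeomorphic_cech_iso (collapse_set0_homeomorphic (tiling_space R phi)).
  have [_ from] :=
    homeomorphic_cech_iso (collapse_set0_homeomorphic (tiling_space R phi')).
  apply: group_iso_trans (to n) (group_iso_trans _ (from n)).
  have extr (B : finType) (psi : substitution B) (L : cis R psi) :
    cis0 R psi `<=` L by move=> x [].
  exact: (@diagram_iso_min (quotient_cohomology R phi)
    (quotient_cohomology R phi') anti _ _ (extr _ _) (extr _ _) iso n).
Qed.
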